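(* Let $k\ge1$. Let $\mu$ be a Borel probability measure on $\mathbb{R}^N$ with finite second moments and whose support has at least $k$ points. Assume $\{\mu_m\}_{m\in\mathbb{N}}$ is a sequence of probability measures on $\mathbb{R}^N$ with finite second moments which converges in the Wasserstein distance $d_2$ to $\mu$. Then $$\lim_{m\to\infty}\min_{\mathbf{z}}F_{\mu_m,k}(\mathbf{z})=\min_{\mathbf{z}}F_{\mu,k}(\mathbf{z}),$$ where the minima are over $\mathbf{z}\in\mathbb{R}^{N\times k}$. Moreover, if $\mathbf{z}_m$ is a minimizer of $F_{\mu_m,k}$ for all $m$, then the set $\{\mathbf{z}_m:m\in\mathbb{N}\}$ is precompact in $\mathbb{R}^{N\times k}$ and all of its accumulation points are minimizers of $F_{\mu,k}$.
   Context: For a measure $\mu$ on $\mathbb{R}^N$ with finite second moments and $\mathbf{z}=(z_1,\dots,z_k)$ with $z_i\in\mathbb{R}^N$, $F_{\mu,k}(\mathbf{z})=\int_{\mathbb{R}^N}d(x,\{z_1,\dots,z_k\})^2\,d\mu(x)$, where $d(x,\cdot)$ is the Euclidean distance to the set. Minimizers of $F_{\mu,k}$ exist. The Wasserstein distance is $d_2(\mu,\tilde\mu)=\min_{\pi\in\Gamma(\mu,\tilde\mu)}\big(\iint|x-y|^2d\pi(x,y)\big)^{1/2}$, with $\Gamma(\mu,\tilde\mu)$ the set of couplings of $\mu$ and $\tilde\mu$. ''Accumulation points'' means limits of subsequences of $\{\mathbf{z}_m\}$. *)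

(* Defs.v *)
From HB Require Import structures.
From mathcomp Require Import all_boot all_order all_algebra.
From mathcomp Require Import all_classical all_reals all_analysis.
Import Order.TTheory GRing.Theory Num.Theory.
Import numFieldNormedType.Exports.

Set Implicit Arguments.
Unset Strict Implicit.
Unset Printing Implicit Defensive.

Local Open Scope classical_set_scope.
Local Open Scope ring_scope.

(* Points of R^N are column vectors.  The library's own norm on matrices is the
   sup norm: it gives the usual topology, but distances below must be Euclidean. *)
Definition borelRn (R : realType) (N : nat) : measurableType _ :=
  g_sigma_algebraType (@open 'cV[R]_N).

Section kmeans.
Context {R : realType} {N : nat}.
Local Open Scope ereal_scope.

Implicit Types mu nu : probability (borelRn R N) R.

Definition enorm (x : 'cV[R]_N) : R := Num.sqrt (\sum_(i < N) x i ord0 ^+ 2)%R.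

Definition dist_set (x : 'cV[R]_N) (A : set 'cV[R]_N) : R :=
  inf [set enorm (x - a)%R | a in A].

Definition finite_second_moment mu : Prop :=
  \int[mu]_x (enorm x ^+ 2)%:E < +oo.

Definition msupport mu : set 'cV[R]_N :=
  [set x | forall U : set 'cV[R]_N, open U -> U x -> 0 < mu U].

(* [z : 'M_(N, k)] is the k-tuple of its columns. *)
Definition centers {k : nat} (z : 'M[R]_(N, k)) : set 'cV[R]_N :=
  range (fun i : 'I_k => col i z).

Definition kF mu (k : nat) (z : 'M[R]_(N, k)) : \bar R :=
  \int[mu]_x (dist_set x (centers z) ^+ 2)%:E.

(* Only the values on measurable sets are specified: a library measure takes
   arbitrary values elsewhere. *)
Definition coupling mu nu :
    set (probability (borelRn R N * borelRn R N)%type R) :=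
  [set P | (forall A : set (borelRn R N), measurable A ->
              P (fst @^-1` A) = mu A) /\
           (forall A : set (borelRn R N), measurable A ->
              P (snd @^-1` A) = nu A)].

(* Written as an infimum, which is the minimum since optimal couplings exist. *)
Definition wasserstein2 mu nu : \bar R :=
  ereal_inf [set sqrte (\int[P]_p (enorm (p.1 - p.2)%R ^+ 2)%:E)
            | P in coupling mu nu].

End kmeans.

Arguments kF {R N} mu k z.

Definition minimizer (R : realType) (T : Type) (f : T -> \bar R) (z : T) : Prop :=
  forall z', (f z <= f z')%E.

Definition is_min (R : realType) (T : Type) (f : T -> \bar R) (v : \bar R) : Prop :=
  exists2 z, minimizer f z & f z = v.

(* Main.v *)
Require Import Defs.
From mathcomp Require Import all_boot all_order all_algebra.
From mathcomp Require Import all_classical all_reals all_analysis.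
From mathcomp Require Import measurable_realfun ring lra.
Import Order.TTheory GRing.Theory Num.Theory.
Import numFieldNormedType.Exports.
Local Open Scope classical_set_scope.
Local Open Scope ring_scope.

Set Implicit Arguments.
Unset Strict Implicit.
Unset Printing Implicit Defensive.

(* For a coupling of [nu] and [mu], the function x |-> d(x, z) being 1-Lipschitz
   and (a + b)^2 <= (1 + t) a^2 + (1 + 1/t) b^2 give
     F_nu(z) <= (1 + t) F_mu(z) + (1 + 1/t) W_2(nu, mu)^2   for all t > 0,
   and symmetrically, uniformly in [z].  Hence the minimal values converge, and
   minimizers of [F_(mu_m)] form a minimizing sequence of the continuous
   function [F_mu].  Compactness comes from a gap: if k-tuples with a repeated
   center all have energy at least c' > c, then {F_mu <= c} is bounded, since
   collapsing a far away center onto one that is near the origin costs only a tail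
   of the second moment.  By induction on k this yields existence of minimizers,
   and the gap holds above the minimum when the support has at least k points,
   since adding a support point strictly improves a (k-1)-tuple. *)

(** * Euclidean norm on column vectors *)

Lemma sqr_enorm (R : realType) (N : nat) (x : 'cV[R]_N) :
  enorm x ^+ 2 = \sum_(i < N) x i ord0 ^+ 2.
Proof. by rewrite sqr_sqrtr// sumr_ge0// => i _; exact: sqr_ge0. Qed.

Lemma enorm_ge0 (R : realType) (N : nat) (x : 'cV[R]_N) : 0 <= enorm x.
Proof. exact: sqrtr_ge0. Qed.
#[local] Hint Extern 0 (is_true (0 <= enorm _)) => exact: enorm_ge0 : core.

Lemma enormN (R : realType) (N : nat) (x : 'cV[R]_N) : enorm (- x) = enorm x.
Proof. by congr Num.sqrt; apply: eq_bigr => i _; rewrite mxE sqrrN. Qed.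

Lemma enorm_distC (R : realType) (N : nat) (x y : 'cV[R]_N) :
  enorm (x - y) = enorm (y - x).
Proof. by rewrite -enormN opprB. Qed.

Lemma enorm0 (R : realType) (N : nat) : enorm (0 : 'cV[R]_N) = 0.
Proof.
rewrite /enorm big1 ?sqrtr0// => i _; by rewrite mxE expr0n.
Qed.

Lemma ler_coord_enorm (R : realType) (N : nat) (x : 'cV[R]_N) (i : 'I_N) :
  `|x i ord0| <= enorm x.
Proof.
rewrite -[leLHS]sqrtr_sqr ler_wsqrtr//.
by rewrite (bigD1 i)//= lerDl sumr_ge0// => j _; exact: sqr_ge0.
Qed.

Lemma enorm_eq0 (R : realType) (N : nat) (x : 'cV[R]_N) : enorm x = 0 -> x = 0.
Proof.
move=> x0; apply/colP => i; rewrite mxE; apply/eqP; rewrite -normr_le0 -x0.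
exact: ler_coord_enorm.
Qed.

(** Cauchy-Schwarz. After multiplying by |x||y| > 0, each term satisfies |x||y| x_i y_i <= (|y|^2
    x_i^2 + |x|^2 y_i^2) / 2, and the right-hand sides add up to |x|^2 |y|^2. *)
Lemma dot_le_enormM (R : realType) (N : nat) (x y : 'cV[R]_N) :
  \sum_(i < N) x i ord0 * y i ord0 <= enorm x * enorm y.
Proof.
have [x0|x0] := eqVneq (enorm x) 0.
  rewrite x0 mul0r big1// => i _.
  by rewrite (enorm_eq0 x0) mxE mul0r.
have [y0|y0] := eqVneq (enorm y) 0.
  rewrite y0 mulr0 big1// => i _.
  by rewrite (enorm_eq0 y0) mxE mulr0.
have xp : 0 < enorm x by rewrite lt0r x0 enorm_ge0.
have yp : 0 < enorm y by rewrite lt0r y0 enorm_ge0.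
have xy0 := mulr_gt0 xp yp.
rewrite -(ler_pM2l xy0) mulr_sumr.
apply: (@le_trans _ _ (\sum_(i < N) (enorm y ^+ 2 * x i ord0 ^+ 2 +
  enorm x ^+ 2 * y i ord0 ^+ 2) / 2)).
  apply: ler_sum => i _.
  rewrite -subr_ge0.
  have -> : (enorm y ^+ 2 * x i ord0 ^+ 2 + enorm x ^+ 2 * y i ord0 ^+ 2) / 2 -
      enorm x * enorm y * (x i ord0 * y i ord0) =
      (enorm y * x i ord0 - enorm x * y i ord0) ^+ 2 / 2 by field.
  by rewrite divr_ge0// sqr_ge0.
rewrite -mulr_suml big_split/= -!mulr_sumr -!sqr_enorm.
rewrite le_eqVlt; apply/orP; left; apply/eqP; by field.
Qed.

Lemma ler_enormD (R : realType) (N : nat) (x y : 'cV[R]_N) :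
  enorm (x + y) <= enorm x + enorm y.
Proof.
rewrite -(@ler_pXn2r _ 2)// ?nnegrE ?addr_ge0// sqrrD !sqr_enorm.
under eq_bigr do rewrite mxE sqrrD.
rewrite !big_split/= lerD2r lerD2l.
by rewrite mulr2n lerD ?dot_le_enormM.
Qed.

Lemma ler_enorm_dist (R : realType) (N : nat) (y x z : 'cV[R]_N) :
  enorm (x - z) <= enorm (x - y) + enorm (y - z).
Proof. by apply: le_trans (ler_enormD _ _); rewrite addrA subrK. Qed.

Lemma enorm_continuous (R : realType) (N : nat) : continuous (@enorm R N).
Proof.
move=> x; apply: (@continuous_comp _ _ _
  (fun y : 'cV[R]_N => \sum_(i < N) y i ord0 ^+ 2) Num.sqrt); last first.
  exact: sqrt_continuous.
move: x; apply: continuous_big => [|i _ x]; first exact: add_continuous.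
apply: (@continuous_comp _ _ _ (fun y : 'cV[R]_N => y i ord0)
  (fun r => r ^+ 2)); last exact: exprn_continuous.
exact: coord_continuous.
Qed.

Lemma continuous_enorm_sub (R : realType) (N : nat) (a : 'cV[R]_N) :
  continuous (fun x : 'cV[R]_N => enorm (x - a)).
Proof.
move=> x; apply: (@continuous_comp _ _ _ (fun y : 'cV[R]_N => y - a) (@enorm R N)).
  by apply: (@continuousB _ _ _ id (cst a)); [exact: cvg_id|exact: cst_continuous].
exact: enorm_continuous.
Qed.

Lemma cvg_enorm_dist0 (R : realType) (N : nat) (x : 'cV[R]_N) :
  enorm (y - x) @[y --> x] --> (0 : R).
Proof.
have := @continuous_enorm_sub R N x x.
by rewrite /continuous_at subrr enorm0.
Qed.

(** * Distance to a finite nonempty set of centers *)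

Section dist_centers.
Context {R : realType} {N k : nat}.
Implicit Types (x y : 'cV[R]_N) (z w : 'M[R]_(N, k.+1)).

Lemma dist_centers_le x z i : dist_set x (centers z) <= enorm (x - col i z).
Proof.
apply: ge_inf; last by exists (col i z) => //; exists i.
by exists 0 => _ [a _ <-].
Qed.

Lemma dist_centersP x z :
  exists i, dist_set x (centers z) = enorm (x - col i z).
Proof.
have [i _ imin] := arg_minP (fun j => enorm (x - col j z)) (erefl : xpredT ord0).
exists i; apply/le_anti; rewrite dist_centers_le/=.
apply: lb_le_inf.
  by exists (enorm (x - col ord0 z)), (col ord0 z) => //; exists ord0.
by move=> _ [_ [j _ <-] <-]; exact: imin.
Qed.

Lemma dist_centers_ge0 x z : 0 <= dist_set x (centers z).
Proof. by have [i ->] := dist_centersP x z. Qed.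

Lemma dist_centers_lip x y z :
  dist_set x (centers z) <= dist_set y (centers z) + enorm (x - y).
Proof.
have [i ->] := dist_centersP y z; rewrite addrC.
exact: le_trans (dist_centers_le _ _ i) (ler_enorm_dist _ _ _).
Qed.

Lemma dist_centers_perturb (e : R) x z w :
  (forall i, enorm (col i z - col i w) <= e) ->
  dist_set x (centers z) <= dist_set x (centers w) + e.
Proof.
move=> zw; have [i ->] := dist_centersP x w.
apply: (le_trans (dist_centers_le x z i)).
apply: (le_trans (ler_enorm_dist (col i w) _ _)).
by rewrite lerD2l enorm_distC.
Qed.

Lemma continuous_dist_centers z :
  continuous (fun x => dist_set x (centers z)).
Proof.
move=> x; have FF : Filter (nbhs x) by exact: nbhs_filter.
apply/cvgrPdist_le => /= e e0.
have c0 := cvg_enorm_dist0 x.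
move/cvgrPdist_le : c0 => /(_ _ e0); apply: filterS => y.
rewrite sub0r normrN ger0_norm// => yx.
rewrite ler_norml; apply/andP; split.
- have := dist_centers_lip y x z; lra.
- have := dist_centers_lip x y z; rewrite (enorm_distC x y); lra.
Qed.

End dist_centers.

(** * Measurability, and the weighted square inequality under the integral *)

Lemma continuous_borelRn_measurable (R : realType) (N : nat)
    (f : 'cV[R]_N -> R) :
  continuous f -> measurable_fun [set: borelRn R N] f.
Proof.
move=> /continuousP cf.
apply: (measurability _ (RGenOpens.measurableE R)) => _ [_ [a [b ->] <-]].
by rewrite setTI; apply: sub_sigma_algebra; apply: cf; exact: interval_open.
Qed.

(** The domain carries the product sigma-algebra, not one defined from the open sets of the product,
    so the proof goes through the coordinates of each factor instead of joint continuity. *)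
Lemma measurable_enorm_dist (R : realType) (N : nat) :
  measurable_fun [set: borelRn R N * borelRn R N]
    (fun p => enorm ((p.1 : 'cV[R]_N) - (p.2 : 'cV[R]_N))).
Proof.
apply: (@measurableT_comp _ _ _ _ _ _ (Num.sqrt : R -> R) _
  (fun p : borelRn R N * borelRn R N =>
    \sum_(i < N) ((p.1 : 'cV[R]_N) - p.2) i ord0 ^+ 2)).
  apply: continuous_measurable_fun; exact: sqrt_continuous.
apply: measurable_sum => i; apply: measurable_funX.
rewrite (_ : (fun _ => _) = (fun p : borelRn R N * borelRn R N =>
    (p.1 : 'cV[R]_N) i ord0 - (p.2 : 'cV[R]_N) i ord0)); last first.
  by apply/funext => p; rewrite !mxE.
have mc : measurable_fun [set: borelRn R N] (fun x : 'cV[R]_N => x i ord0).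
  by apply: continuous_borelRn_measurable; exact: coord_continuous.
apply: measurable_funB.
- exact: (measurableT_comp mc measurable_fst).
- exact: (measurableT_comp mc measurable_snd).
Qed.

(** The difference of the two sides is (t a - b)^2 / t. *)
Lemma sqrD_le (R : realFieldType) (t a b : R) : 0 < t ->
  (a + b) ^+ 2 <= (1 + t) * a ^+ 2 + (1 + t^-1) * b ^+ 2.
Proof.
move=> t0; rewrite -subr_ge0.
have -> : (1 + t) * a ^+ 2 + (1 + t^-1) * b ^+ 2 - (a + b) ^+ 2 =
    (t * a - b) ^+ 2 / t by field; rewrite gt_eqF.
by rewrite divr_ge0 ?sqr_ge0// ltW.
Qed.

(** The common source of the energy estimates: finiteness, moving the centers and changing the
    measure are all instances. The integrals may be infinite. *)
Lemma integral_sqr_le d (T : measurableType d) (R : realType)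
    (P : {measure set T -> \bar R}) (f g h : T -> R) (t : R) : 0 < t ->
  measurable_fun setT f -> measurable_fun setT g -> measurable_fun setT h ->
  (forall x, 0 <= f x <= g x + h x) ->
  (\int[P]_x (f x ^+ 2)%:E <= (1 + t)%:E * \int[P]_x (g x ^+ 2)%:E +
     (1 + t^-1)%:E * \int[P]_x (h x ^+ 2)%:E)%E.
Proof.
move=> t0 mf mg mh fgh.
have t1 : 0 <= 1 + t by rewrite addr_ge0// ltW.
have t2 : 0 <= 1 + t^-1 by rewrite addr_ge0// invr_ge0 ltW.
have msq (u : T -> R) : measurable_fun setT u ->
    measurable_fun setT (fun x => (u x ^+ 2)%:E).
  by move=> mu; apply/measurable_EFinP; exact: measurable_funX.
have sq0 (u : T -> R) x : setT x -> (0 <= (u x ^+ 2)%:E)%E.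
  by rewrite lee_fin sqr_ge0.
rewrite -!ge0_integralZl_EFin//; [|exact: sq0|exact: msq|exact: sq0|exact: msq].
rewrite -ge0_integralD//; first last.
- by apply: measurable_funeM; exact: msq.
- by move=> x _; rewrite mule_ge0 ?lee_fin// sqr_ge0.
- by apply: measurable_funeM; exact: msq.
- by move=> x _; rewrite mule_ge0 ?lee_fin// sqr_ge0.
apply: ge0_le_integral => //; [exact: sq0|exact: msq| |].
  by apply: emeasurable_funD; apply: measurable_funeM; exact: msq.
move=> x _; rewrite -!EFinM -EFinD lee_fin.
have /andP[f0 fgx] := fgh x.
by apply: (le_trans _ (sqrD_le _ _ t0)); rewrite ler_pXn2r ?nnegrE ?(le_trans f0).
Qed.

(** * Estimates for the energy: finiteness, moving the centers, changing the measure *)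

Section kF_estimates.
Context {R : realType} {N k : nat}.
Implicit Types (mu nu : probability (borelRn R N) R) (z w : 'M[R]_(N, k.+1)).
Local Open Scope ereal_scope.

Lemma measurable_dist_centers z :
  measurable_fun [set: borelRn R N] (fun x => dist_set x (centers z)).
Proof.
by apply: continuous_borelRn_measurable; exact: continuous_dist_centers.
Qed.

Lemma measurable_enorm : measurable_fun [set: borelRn R N] (@enorm R N).
Proof. by apply: continuous_borelRn_measurable; exact: enorm_continuous. Qed.

Lemma integral_cst_prob d (T : measurableType d) (P : probability T R) (c : R) :
  \int[P]_x c%:E = c%:E.
Proof.
by rewrite integral_cst// -[RHS]mule1; congr (_ * _); exact: probability_setT.
Qed.

Lemma kF_ge0 mu z : 0 <= kF mu k.+1 z.
Proof. by apply: integral_ge0 => x _; rewrite lee_fin sqr_ge0. Qed.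

Lemma kF_fin_num mu z : finite_second_moment mu -> kF mu k.+1 z \is a fin_num.
Proof.
move=> mu2; rewrite ge0_fin_numE ?kF_ge0//.
(* Weight t = 1, with d(x, z) <= |x| + |z_0|. *)
apply: (@le_lt_trans _ _ ((1 + 1)%:E * \int[mu]_x (enorm x ^+ 2)%:E +
     (1 + 1^-1)%:E * \int[mu]_x (enorm (col ord0 z) ^+ 2)%:E)).
  apply: integral_sqr_le => //.
  - exact: measurable_dist_centers.
  - exact: measurable_enorm.
  - move=> x; rewrite dist_centers_ge0/=.
    apply: (le_trans (dist_centers_le _ _ ord0)).
    by rewrite -(enormN (col _ _)); exact: ler_enormD.
rewrite integral_cst_prob lte_add_pinfty// ?ltry//.
rewrite lte_mul_pinfty ?lee_fin//.
Qed.

Lemma kF_perturb mu z w (t e : R) : (0 < t)%R -> (0 <= e)%R ->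
  (forall i, (enorm (col i z - col i w) <= e)%R) ->
  kF mu k.+1 z <= (1 + t)%:E * kF mu k.+1 w + ((1 + t^-1) * e ^+ 2)%:E.
Proof.
move=> t0 e0 zw; rewrite EFinM -(integral_cst_prob mu (e ^+ 2)%R).
apply: integral_sqr_le => //; try exact: measurable_dist_centers.
by move=> x; rewrite dist_centers_ge0/= dist_centers_perturb.
Qed.

(** Change of variables along [phi]: the pushforward of [P] agrees with [mu] on measurable sets, and
    this determines the integral. *)
Lemma integral_marginal mu (P : probability (borelRn R N * borelRn R N)%type R)
    (phi : borelRn R N * borelRn R N -> borelRn R N) (f : borelRn R N -> \bar R) :
  measurable_fun setT phi ->
  (forall A : set (borelRn R N), measurable A -> P (phi @^-1` A) = mu A) ->
  measurable_fun setT f -> (forall x, 0 <= f x) ->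
  \int[mu]_x f x = \int[P]_p f (phi p).
Proof.
move=> mphi Pmu mf f0.
transitivity (\int[pushforward P phi]_x f x).
  by apply: eq_measure_integral => A mA _ /=; rewrite /pushforward Pmu.
by rewrite ge0_integral_pushforward.
Qed.

Lemma kF_wasserstein mu nu z (t e : R) : (0 < t)%R ->
  wasserstein2 nu mu < e%:E ->
  kF nu k.+1 z <= (1 + t)%:E * kF mu k.+1 z + ((1 + t^-1) * e ^+ 2)%:E /\
  kF mu k.+1 z <= (1 + t)%:E * kF nu k.+1 z + ((1 + t^-1) * e ^+ 2)%:E.
Proof.
(* The strict bound on the infimum yields a coupling of cost below [e], so no optimal coupling has
   to be produced. *)
move=> t0 /ereal_inf_lt[_ [P [P1 P2] <-] Pe].
set I := \int[P]_p _ in Pe.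
have I0 : 0 <= I by apply: integral_ge0 => x _; rewrite lee_fin sqr_ge0.
have e0 : (0 < e)%R.
  by rewrite -lte_fin (le_lt_trans _ Pe)// sqrte_ge0.
have Ie : I <= (e ^+ 2)%:E.
  by rewrite -lee_sqrt ?lee_fin ?sqr_ge0//= sqrtr_sqr gtr0_norm// ltW.
have mD : measurable_fun [set: borelRn R N]
    (fun x => (dist_set x (centers z) ^+ 2)%:E : \bar R).
  by apply/measurable_EFinP/measurable_funX; exact: measurable_dist_centers.
have D0 x : 0 <= (dist_set x (centers z) ^+ 2)%:E by rewrite lee_fin sqr_ge0.
have F1 : kF nu k.+1 z = \int[P]_p (dist_set p.1 (centers z) ^+ 2)%:E.
  exact: (integral_marginal measurable_fst P1 mD D0).
have F2 : kF mu k.+1 z = \int[P]_p (dist_set p.2 (centers z) ^+ 2)%:E.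
  exact: (integral_marginal measurable_snd P2 mD D0).
have m1 : measurable_fun [set: borelRn R N * borelRn R N]
    (fun p => dist_set p.1 (centers z)).
  exact: (measurableT_comp (measurable_dist_centers z) measurable_fst).
have m2 : measurable_fun [set: borelRn R N * borelRn R N]
    (fun p => dist_set p.2 (centers z)).
  exact: (measurableT_comp (measurable_dist_centers z) measurable_snd).
have tI : (1 + t^-1)%:E * I <= ((1 + t^-1) * e ^+ 2)%:E.
  by rewrite EFinM lee_wpmul2l// lee_fin addr_ge0// invr_ge0 ltW.
split; rewrite F1 F2.
- apply: le_trans (leeD2l _ tI).
  apply: integral_sqr_le => //; first exact: measurable_enorm_dist.
  by move=> p; rewrite dist_centers_ge0/= dist_centers_lip.
- apply: le_trans (leeD2l _ tI).
  apply: integral_sqr_le => //; first exact: measurable_enorm_dist.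
  by move=> p; rewrite dist_centers_ge0/= enorm_distC dist_centers_lip.
Qed.

End kF_estimates.

(** * Compact boxes, tails of the second moment and bounded sublevel sets *)

Lemma compact_mx_box (R : realType) (m n : nat) (B : R) :
  compact [set z : 'M[R]_(m, n) | forall i j, `|z i j| <= B].
Proof.
have cbox : compact
    [set v : 'rV[R]_(m * n) | forall i, `[- B, B]%classic (v ord0 i)].
  by apply: (@rV_compact _ _ (fun=> `[- B, B]%classic)) => i; exact: segment_compact.
have cvec : continuous (@vec_mx R m n).
  move=> v s /= /nbhs_ballP[e e0 es]; apply/nbhs_ballP; exists e => //= u [_ vu].
  by apply: es; split => // i j; rewrite !mxE; exact: vu.
(* The box is the continuous image of a product of segments, by reshaping row vectors into
   matrices. *)
rewrite (_ : [set _ | _] = @vec_mx R m n @`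
    [set v : 'rV[R]_(m * n) | forall i, `[- B, B]%classic (v ord0 i)]).
  by apply: continuous_compact cbox; exact: continuous_subspaceT.
apply/seteqP; split => [z zB|_ [v vB <-] i j] /=.
  exists (mxvec z); last exact: mxvecK.
  move=> i /=; case/mxvec_indexP: i => i j.
  by rewrite mxvecE in_itv/= -ler_norml zB.
by rewrite mxE ler_norml; have := vB (mxvec_index i j); rewrite /= in_itv.
Qed.

Section tail.
Context {R : realType} {N : nat}.
Variable mu : probability (borelRn R N) R.
Hypothesis mu2 : finite_second_moment mu.
Local Open Scope ereal_scope.

Lemma measurable_enorm_ge (r : R) :
  measurable [set x : borelRn R N | (r <= enorm x)%R].
Proof.
rewrite (_ : [set _ | _] = (@enorm R N) @^-1` `[r, +oo[%classic); last first.
  by apply/seteqP; split => x /=; rewrite in_itv/= andbT.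
by rewrite -[X in measurable X]setTI; apply: measurable_enorm.
Qed.

Lemma integrable_enormD_sqr (B : R) : (0 <= B)%R ->
  mu.-integrable setT (fun x => ((enorm x + B) ^+ 2)%:E).
Proof.
move=> B0; have mB : measurable_fun [set: borelRn R N] (fun x => (enorm x + B)%R).
  by apply: measurable_funD => //; exact: measurable_enorm.
apply/integrableP; split.
  by apply/measurable_EFinP; apply: measurable_funX.
under eq_integral => x _ do rewrite gee0_abs ?lee_fin ?sqr_ge0//.
apply: (@le_lt_trans _ _ ((1 + 1)%:E * \int[mu]_x (enorm x ^+ 2)%:E +
     (1 + 1^-1)%:E * \int[mu]_x (B ^+ 2)%:E)).
  apply: integral_sqr_le => //; first exact: measurable_enorm.
  by move=> x; rewrite lexx andbT addr_ge0.
rewrite integral_cst_prob lte_add_pinfty// ?ltry//.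
by rewrite lte_mul_pinfty ?lee_fin.
Qed.

(** Dominated convergence: at a fixed x the integrand vanishes once n > |x|, and (|x| + B)^2 is an
    integrable bound. *)
Lemma tail_second_moment (B e : R) : (0 <= B)%R -> (0 < e)%R -> exists n : nat,
  \int[mu]_x ((enorm x + B) ^+ 2 *
    \1_[set x : borelRn R N | (n%:R <= enorm x)%R] x)%:E < e%:E.
Proof.
move=> B0 e0; have mB : measurable_fun [set: borelRn R N] (fun x => (enorm x + B)%R).
  by apply: measurable_funD => //; exact: measurable_enorm.
pose g n (x : borelRn R N) := ((enorm x + B) ^+ 2 *
    \1_[set x : borelRn R N | (n%:R <= enorm x)%R] x)%:E.
have : \int[mu]_x g n x @[n --> \oo] --> 0.
  rewrite -[X in _ --> X](integral_cst_prob mu 0).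
  apply: (dominated_cvg measurableT _ _ _ (integrable_enormD_sqr B0)) => //.
  - move=> n; apply/measurable_EFinP; apply: measurable_funM.
      exact: measurable_funX.
    by apply: measurable_indic; exact: measurable_enorm_ge.
  - move=> x _; apply: cvg_near_cst.
    exists (Num.bound (enorm x)) => // n /= xn; rewrite /g indicE memNset ?mulr0//=.
    apply/negP; rewrite -ltNge; apply: lt_le_trans (archi_boundP _) _ => //.
    by rewrite ler_nat.
  - move=> n x _; rewrite /g gee0_abs lee_fin.
      by rewrite ler_piMr ?sqr_ge0// indicE; case: (_ \in _).
    by apply: mulr_ge0; [exact: sqr_ge0|rewrite indicE].
move=> /fine_cvgP[gfin gcvg].
have /cvgrPdist_lt /(_ _ e0) ge := gcvg.
near \oo => n; exists n.
have gn : \int[mu]_x g n x \is a fin_num by near: n.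
rewrite -/(g n) -(fineK gn) lte_fin.
have : (`|0 - fine (\int[mu]_x g n x)| < e)%R by near: n.
by rewrite sub0r normrN => /(le_lt_trans (ler_norm _)).
Unshelve. all: by end_near. Qed.

(* With a single center ([k = 0]) no center is repeated and [c'] is arbitrary. *)
Lemma kF_sublevel_bounded (k : nat) (c c' : R) : (c < c')%R ->
  (forall w : 'M[R]_(N, k.+1), (exists i j, i != j /\ col i w = col j w) ->
    c'%:E <= kF mu k.+1 w) ->
  exists B : R, forall z : 'M[R]_(N, k.+1), kF mu k.+1 z <= c%:E ->
    forall i, (enorm (col i z) <= B)%R.
Proof.
move=> cc' degen.
set I2 := \int[mu]_x (enorm x ^+ 2)%:E.
have I2fin : I2 \is a fin_num.
  by rewrite ge0_fin_numE//; apply: integral_ge0 => x _; rewrite lee_fin sqr_ge0.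
(* The weight t = 1 gives d(0, z)^2 <= 2 F(z) + 2 \int |x|^2, and [B0] is the resulting bound on
   d(0, z) when F(z) <= c. *)
pose B0 := Num.sqrt (2 * c + 2 * fine I2)%R.
have B00 : (0 <= B0)%R by exact: sqrtr_ge0.
(* F z <= c forces a center within [B0] of the origin. *)
have near_center z : kF mu k.+1 z <= c%:E -> exists j, (enorm (col j z) <= B0)%R.
  move=> Fc; have [j zj] := dist_centersP 0 z; exists j.
  rewrite -enormN -sub0r -zj.
  rewrite -[leLHS](ger0_norm (dist_centers_ge0 _ _)) -sqrtr_sqr ler_wsqrtr//.
  rewrite -lee_fin -(integral_cst_prob mu).
  apply: (@le_trans _ _ ((1 + 1)%:E * kF mu k.+1 z + (1 + 1^-1)%:E * I2)).
    apply: integral_sqr_le => //; first exact: measurable_dist_centers.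
      exact: measurable_enorm.
    move=> x; rewrite dist_centers_ge0/=.
    by apply: (le_trans (dist_centers_lip 0 x z)); rewrite sub0r enormN.
  rewrite invr1 [leRHS]EFinD !EFinM (fineK I2fin) leeD2r//.
  by rewrite lee_wpmul2l// lee_fin.
have [n tail] := tail_second_moment B00 (e := (c' - c)%R) ltac:(by rewrite subr_gt0).
(* If |z_i| > 2n + B0 and |x| < n, then |x - z_i| > n + B0 > |x| + B0 >= |x - z_j|. The summand [B0]
   also forces i != j. *)
exists (2 * n%:R + B0)%R => z Fc i; rewrite leNgt; apply/negP => zi.
have [j zj] := near_center z Fc.
have ij : i != j.
  apply/eqP => ij; move: zi; rewrite ij ltNge => /negP; apply.
  by rewrite (le_trans zj)// lerDr mulr_ge0.
(* Only points x with |x| >= n can be closer to [col i z] than to [col j z]. *)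
pose w := (\matrix_(a, b) (if b == i then z a j else z a b))%R.
have colw b : col b w = if b == i then col j z else col b z.
  by apply/colP => a; rewrite !mxE; case: ifP => _; rewrite mxE.
have /degen : exists i j, i != j /\ col i w = col j w.
  by exists i, j; split => //; rewrite !colw eqxx; case: ifP.
apply/negP; rewrite -ltNge.
have mdist (u : 'M[R]_(N, k.+1)) : measurable_fun [set: borelRn R N]
    (fun x => (dist_set x (centers u) ^+ 2)%:E : \bar R).
  by apply/measurable_EFinP/measurable_funX; exact: measurable_dist_centers.
have mtail : measurable_fun [set: borelRn R N] (fun x => ((enorm x + B0) ^+ 2 *
    \1_[set x : borelRn R N | (n%:R <= enorm x)%R] x)%:E : \bar R).
  apply/measurable_EFinP/measurable_funM.
    by apply: measurable_funX; apply: measurable_funD => //; exact: measurable_enorm.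
  by apply: measurable_indic; exact: measurable_enorm_ge.
(* Here [w] is [z] with center i moved onto center j. Pointwise, d(x, w)^2 exceeds d(x, z)^2 by at
   most the tail integrand, so F(w) < c + (c' - c) = c', against the bound for degenerate tuples. *)
apply: (@le_lt_trans _ _ (\int[mu]_x ((dist_set x (centers z) ^+ 2)%:E +
  ((enorm x + B0) ^+ 2 * \1_[set x : borelRn R N | (n%:R <= enorm x)%R] x)%:E))).
  apply: ge0_le_integral => //.
  - by move=> x _; rewrite lee_fin sqr_ge0.
  - by apply: emeasurable_funD; [exact: mdist|exact: mtail].
  move=> x _; rewrite -EFinD lee_fin.
  have [b zb] := dist_centersP x z.
  have sqr_mono (u v : R) : (0 <= u -> u <= v -> u ^+ 2 <= v ^+ 2)%R.
    by move=> u0 uv; rewrite ler_pXn2r ?nnegrE// (le_trans u0).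
  have wj : (dist_set x (centers w) <= enorm x + B0)%R.
    apply: (le_trans (dist_centers_le x w i)); rewrite colw eqxx.
    by apply: (le_trans (ler_enormD _ _)); rewrite enormN lerD2l.
  rewrite indicE; have [nx|nx] := leP n%:R (enorm x).
    rewrite mem_set//= mulr1; apply: (le_trans (sqr_mono _ _ _ wj)).
      exact: dist_centers_ge0.
    by rewrite lerDr sqr_ge0.
  rewrite memNset/= ?mulr0 ?addr0; last by apply/negP; rewrite -ltNge.
  apply: sqr_mono; first exact: dist_centers_ge0.
  rewrite zb; have [bi|bi] := eqVneq b i; last first.
    by apply: (le_trans (dist_centers_le x w b)); rewrite colw (negbTE bi).
  apply: (le_trans wj); rewrite bi enorm_distC.
  have := ler_enormD (col i z - x) x; rewrite subrK.
  by lra.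
rewrite ge0_integralD//=; first last.
- by move=> x _; rewrite lee_fin; apply: mulr_ge0; [exact: sqr_ge0|rewrite indicE].
- by move=> x _; rewrite lee_fin sqr_ge0.
apply: (@lt_le_trans _ _ (c%:E + (c' - c)%:E)); last by rewrite -EFinD addrC subrK.
exact: (lee_ltD (kF_fin_num z mu2) Fc tail).
Qed.
End tail.

(** * Continuity of the energy, existence of minimizers and the gap *)

Lemma cvg_enorm_col_dist0 (R : realType) (N k : nat) (z : 'M[R]_(N, k)) (i : 'I_k) :
  enorm (col i w - col i z) @[w --> z] --> (0 : R).
Proof.
have ccol : continuous (@col R N k i).
  move=> v s /= /nbhs_ballP[e e0 es]; apply/nbhs_ballP; exists e => //= u [_ vu].
  by apply: es; split => // a b; rewrite !mxE; exact: vu.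
exact: (cvg_comp _ _ (ccol z) (cvg_enorm_dist0 (col i z))).
Qed.

(** Inserting the first bound into t a and using t <= 1 gives t a <= t (2 b + 2). The estimate thus
    involves only [b], which is the fixed value in the applications. *)
Lemma norm_sub_le_of_relative (R : realFieldType) (t a b : R) :
  0 <= a -> 0 <= b -> 0 < t -> t <= 1 ->
  a <= (1 + t) * b + 2 * t -> b <= (1 + t) * a + 2 * t ->
  `|b - a| <= t * (2 * b + 4).
Proof.
move=> a0 b0 t0 t1 ab ba; rewrite ler_norml; apply/andP; split; nra.
Qed.

Section existence.
Context {R : realType} {N : nat}.
Variable mu : probability (borelRn R N) R.
Hypothesis mu2 : finite_second_moment mu.
Local Open Scope ereal_scope.

Lemma fine_kF_ge0 k z : (0 <= fine (kF mu k.+1 z))%R.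
Proof. by rewrite fine_ge0// kF_ge0. Qed.

Lemma continuous_fine_kF k : continuous (fun z => fine (kF mu k.+1 z)).
Proof.
move=> z; have FF : Filter (nbhs z) by exact: nbhs_filter.
apply/cvgrPdist_le => /= e e0.
have Fz0 := fine_kF_ge0 z; set Fz := fine _ in Fz0 *.
have D0 : (0 < 2 * Fz + 4)%R by lra.
pose t := Num.min 1%R (e / (2 * Fz + 4))%R.
have t0 : (0 < t)%R by rewrite lt_min ltr01 divr_gt0.
have t1 : (t <= 1)%R by rewrite ge_min lexx.
have te : (t * (2 * Fz + 4) <= e)%R.
  by rewrite -ler_pdivlMr// ge_min lexx orbT.
(* The centers are allowed to move by the weight [t] itself, so that the error term is t^2 + t <= 2
   t. *)
have tt : ((1 + t^-1) * t ^+ 2 <= 2 * t)%R.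
  by rewrite expr2 mulrDl mul1r mulrA mulVf ?gt_eqF// mul1r; nra.
have : \forall w \near z, forall i, (enorm (col i w - col i z) <= t)%R.
  apply: (@filter_forall _ 'I_k.+1
    (fun i (w : 'M[R]_(N, k.+1)) => (enorm (col i w - col i z) <= t)%R) _ FF) => i.
  have /cvgrPdist_le /(_ _ t0) := @cvg_enorm_col_dist0 R N k.+1 z i.
  by apply: filterS => w; rewrite sub0r normrN ger0_norm.
apply: filterS => w wz; apply: le_trans te.
have real_le u v : (forall i, (enorm (col i u - col i v) <= t)%R) ->
    (fine (kF mu k.+1 u) <= (1 + t) * fine (kF mu k.+1 v) + 2 * t)%R.
  move=> uv; rewrite -lee_fin fineK ?kF_fin_num//.
  apply: (le_trans (kF_perturb mu t0 (ltW t0) uv)).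
  rewrite [leRHS]EFinD [X in _ <= X + _]EFinM fineK ?kF_fin_num//.
  by rewrite leeD2l// lee_fin.
apply: norm_sub_le_of_relative; rewrite ?fine_kF_ge0//; apply: real_le => // i.
by rewrite enorm_distC.
Qed.

(** The sublevel set lies in a compact box, where the continuous energy attains its minimum; outside
    the box the energy exceeds [c], hence the value at [z0]. *)
Lemma minimizer_of_bounded_sublevel k (z0 : 'M[R]_(N, k.+1)) (c : R) :
  kF mu k.+1 z0 <= c%:E ->
  (exists B : R, forall z, kF mu k.+1 z <= c%:E ->
    forall i, (enorm (col i z) <= B)%R) ->
  exists z, minimizer (kF mu k.+1) z.
Proof.
move=> z0c [B sub].
pose K := [set z : 'M[R]_(N, k.+1) | forall i j, (`|z i j| <= B)%R].
have subK z : kF mu k.+1 z <= c%:E -> K z.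
  move=> zc i j; apply: le_trans (sub _ zc j).
  by have := ler_coord_enorm (col j z) i; rewrite mxE.
have K0 : K !=set0 by exists z0; exact: subK.
have cK : {within K, continuous (fun z => fine (kF mu k.+1 z))}.
  by apply: continuous_subspaceT; exact: continuous_fine_kF.
have [z _ zmin] := compact_EVT_min K0 (@compact_mx_box _ _ _ _) cK.
have zle z' : K z' -> kF mu k.+1 z <= kF mu k.+1 z'.
  move=> Kz'; rewrite -(fineK (kF_fin_num z mu2)) -(fineK (kF_fin_num z' mu2)).
  by rewrite lee_fin zmin// inE.
exists z => z'; have [z'c|z'c] := leP (kF mu k.+1 z') c%:E.
  by apply: zle; exact: subK.
by rewrite (le_trans (zle z0 (subK _ z0c)))// (le_trans z0c)// ltW.
Qed.

(** The deleted center is still present as column j. *)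
Lemma centers_col' k (z : 'M[R]_(N, k.+1)) (i j : 'I_k.+1) :
  i != j -> col i z = col j z -> centers z = centers (col' i z).
Proof.
move=> ij zij; apply/seteqP; split => _ [a _ <-].
  have col'E b : col b (col' i z) = col (lift i b) z.
    by apply/colP => r; rewrite !mxE.
  case: (unliftP i a) => [b ->|->]; first by exists b.
  move: ij; rewrite zij; case: (unliftP i j) => [b ->|->]; last by rewrite eqxx.
  by exists b.
by exists (lift i a) => //; apply/colP => r; rewrite !mxE.
Qed.

Lemma kF_centers k k' (z : 'M[R]_(N, k)) (z' : 'M[R]_(N, k')) :
  centers z = centers z' -> kF mu k z = kF mu k' z'.
Proof. by rewrite /kF => ->. Qed.

Lemma degenerate_kF_ge k (w : 'M[R]_(N, k.+1)) (z : 'M[R]_(N, k.+2)) :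
  minimizer (kF mu k.+1) w ->
  (exists i j, i != j /\ col i z = col j z) -> kF mu k.+1 w <= kF mu k.+2 z.
Proof.
by move=> wmin [i [j [ij zij]]]; rewrite (kF_centers (centers_col' ij zij)).
Qed.

Lemma exists_minimizer k : exists z, minimizer (kF mu k.+1) z.
Proof.
elim: k => [|k [w wmin]].
  (* A single center cannot be repeated, so any level above F(0) serves as [c']. *)
  pose c := fine (kF mu 1 0).
  apply: (@minimizer_of_bounded_sublevel _ 0 c); first by rewrite fineK// kF_fin_num.
  apply: (kF_sublevel_bounded mu2 (c' := (c + 1)%R)); first by rewrite ltrDl.
  by move=> z [i [j [+ _]]]; rewrite !ord1 eqxx.
(* Either an additional center never beats the minimum for one center fewer, or some tuple does. *)
have [min|] := pselect (forall z, kF mu k.+1 w <= kF mu k.+2 z).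
  (* The default [ord0] makes column 0 a second copy of the first center of [w], so the set of
     centers is unchanged. *)
  pose z := (\matrix_(a, b) w a (odflt ord0 (unlift ord0 b)))%R : 'M[R]_(N, k.+2).
  exists z => z'; suff -> : kF mu k.+2 z = kF mu k.+1 w by exact: min.
  apply: kF_centers; apply/seteqP; split => _ [b _ <-].
    by exists (odflt ord0 (unlift ord0 b)) => //; apply/colP => a; rewrite !mxE.
  by exists (lift ord0 b) => //; apply/colP => a; rewrite !mxE liftK.
move=> /existsNP[z0 /negP]; rewrite -ltNge => z0w.
apply: (@minimizer_of_bounded_sublevel _ z0 (fine (kF mu k.+2 z0))).
  by rewrite fineK// kF_fin_num.
(* Degenerate tuples cost at least F(w) > F(z0), which is the gap needed at level F(z0). *)
apply: (kF_sublevel_bounded mu2 (c' := fine (kF mu k.+1 w))).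
  by rewrite fine_lt ?kF_fin_num.
by move=> z dz; rewrite fineK ?kF_fin_num//; exact: degenerate_kF_ge.
Qed.

(** With at least two centers, [c] is the minimal energy for one center fewer. It is strictly larger
    because a support point away from those centers, added to them, lowers the energy. *)
Lemma minimizer_gap k (z : 'M[R]_(N, k.+1)) :
  (`I_k.+1 #<= msupport mu)%card -> minimizer (kF mu k.+1) z ->
  exists2 c : R, kF mu k.+1 z < c%:E &
    forall w : 'M[R]_(N, k.+1), (exists i j, i != j /\ col i w = col j w) ->
      c%:E <= kF mu k.+1 w.
Proof.
case: k z => [z _ _|k z supp zmin].
  exists (fine (kF mu 1 z) + 1)%R.
    by rewrite -(fineK (kF_fin_num z mu2)) lte_fin ltrDl.
  by move=> w [i [j [+ _]]]; rewrite !ord1 eqxx.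
have [w wmin] := exists_minimizer k.
exists (fine (kF mu k.+1 w)); rewrite fineK ?kF_fin_num//; last first.
  by move=> u; exact: degenerate_kF_ge.
(* By cardinality: the support has at least k+2 points, while [w] has at most k+1 centers. *)
have [p pmu pw] : exists2 p, msupport mu p & ~ centers w p.
  apply: contrapT => H.
  have sw : msupport mu `<=` centers w.
    by move=> p pmu; apply: contrapT => pw; apply: H; exists p.
  have := card_le_trans supp (subset_card_le sw).
  move=> /card_le_trans /(_ (card_image_le _ _)).
  by rewrite -(card_le_eqr card_II) card_le_II ltnn.
pose u := (\matrix_(a, b) if unlift ord0 b is Some b' then w a b' else p a ord0)%R
  : 'M[R]_(N, k.+2).
apply: (le_lt_trans (zmin u)).
pose d := dist_set p (centers w).
have d0 : (0 < d)%R.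
  have [i di] := dist_centersP p w.
  rewrite lt0r dist_centers_ge0 andbT; apply/eqP => d0; apply: pw.
  exists i => //; apply/esym/eqP; rewrite -subr_eq0; apply/eqP/enorm_eq0.
  by rewrite -di.
(* On this ball d(x, u) <= d/4 and d(x, w) >= 3d/4, so the squares differ by at least 9d^2/16 -
   d^2/16 = d^2/2. The ball has positive mass since [p] is in the support. *)
pose U := [set x : 'cV[R]_N | (enorm (x - p) < d / 4)%R].
have cU : continuous (fun x : 'cV[R]_N => enorm (x - p)).
  exact: continuous_enorm_sub.
have oU : open U.
  rewrite (_ : U = (fun x : 'cV[R]_N => enorm (x - p)) @^-1` `]-oo, (d / 4)%R[).
    by move/continuousP : cU; apply; exact: interval_open.
  by apply/seteqP; split => x /=; rewrite in_itv.
have mU : measurable (U : set (borelRn R N)) by exact: sub_sigma_algebra.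
have muU : 0 < mu U.
  by apply: pmu => //; rewrite /U/= subrr enorm0 divr_gt0.
have mdist k' (v : 'M[R]_(N, k'.+1)) : measurable_fun [set: borelRn R N]
    (fun x => (dist_set x (centers v) ^+ 2)%:E : \bar R).
  by apply/measurable_EFinP/measurable_funX; exact: measurable_dist_centers.
have mI : measurable_fun [set: borelRn R N]
    (fun x => (d ^+ 2 / 2)%:E * (\1_U x)%:E : \bar R).
  apply: measurable_funeM; apply/measurable_EFinP; exact: measurable_indic.
have I0 (x : borelRn R N) : setT x -> 0 <= (d ^+ 2 / 2)%:E * (\1_U x)%:E.
  by move=> _; rewrite -EFinM lee_fin mulr_ge0// divr_ge0// sqr_ge0.
apply: (@lt_le_trans _ _ (kF mu k.+2 u + (d ^+ 2 / 2)%:E * mu U)).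
  rewrite lteDl ?kF_fin_num// mule_gt0// lte_fin divr_gt0// exprn_gt0//.
have -> : (d ^+ 2 / 2)%:E * mu U = \int[mu]_x ((d ^+ 2 / 2)%:E * (\1_U x)%:E).
  rewrite ge0_integralZl_EFin//.
  - by rewrite integral_indic// setIT.
  - by apply/measurable_EFinP; exact: measurable_indic.
  - by rewrite divr_ge0// sqr_ge0.
rewrite -ge0_integralD//; last by move=> x _; rewrite lee_fin sqr_ge0.
apply: ge0_le_integral => //.
- by move=> x _; apply: adde_ge0; [rewrite lee_fin sqr_ge0|exact: I0].
- by apply: emeasurable_funD; [exact: mdist|exact: mI].
move=> x _; rewrite -EFinM -EFinD lee_fin.
have uw : (dist_set x (centers u) <= dist_set x (centers w))%R.
  have [i ->] := dist_centersP x w.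
  apply: (le_trans (dist_centers_le _ _ (lift ord0 i))).
  rewrite (_ : col (lift ord0 i) u = col i w)//.
  by apply/colP => a; rewrite !mxE liftK.
have u0 := dist_centers_ge0 x u.
rewrite indicE; have [/set_mem xU|xU] := boolP (x \in U); last first.
  by rewrite mulr0 addr0 ler_pXn2r ?nnegrE// (le_trans u0).
have up : (dist_set x (centers u) <= d / 4)%R.
  apply: (le_trans (dist_centers_le _ _ ord0)).
  rewrite (_ : col ord0 u = p); first exact: ltW.
  by apply/colP => a; rewrite !mxE unlift_none.
have wp : (d <= dist_set x (centers w) + d / 4)%R.
  apply: (le_trans (dist_centers_lip p x w)); rewrite lerD2l enorm_distC; exact: ltW.
rewrite mulr1; nra.
Qed.

End existence.

(** * Stability under Wasserstein convergence *)

Section stability.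
Context {R : realType} {N k : nat}.
Variables (mu : probability (borelRn R N) R)
  (mu_ : nat -> probability (borelRn R N) R).
Hypotheses (mu2 : finite_second_moment mu)
  (mu_2 : forall m, finite_second_moment (mu_ m))
  (cvg_mu : (wasserstein2 (mu_ m) mu @[m --> \oo] --> 0)%E).

(** The Wasserstein comparison with distance below [t] and weight [t]; the threshold on m does not
    depend on [z], so [z] may later be taken to vary with m. *)
Lemma near_kF (t : R) : 0 < t -> t <= 1 -> \forall m \near \oo,
  forall z : 'M[R]_(N, k.+1),
    fine (kF (mu_ m) k.+1 z) <= (1 + t) * fine (kF mu k.+1 z) + 2 * t /\
    fine (kF mu k.+1 z) <= (1 + t) * fine (kF (mu_ m) k.+1 z) + 2 * t.
Proof.
move=> t0 t1; have tt : (1 + t^-1) * t ^+ 2 <= 2 * t.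
  by rewrite expr2 mulrDl mul1r mulrA mulVf ?gt_eqF// mul1r; nra.
have /fine_cvgP[Wfin /cvgrPdist_lt /(_ _ t0) Wt] := cvg_mu.
near=> m => z.
have Wm : (wasserstein2 (mu_ m) mu < t%:E)%E.
  have Wf : wasserstein2 (mu_ m) mu \is a fin_num by near: m.
  rewrite -(fineK Wf) lte_fin.
  have : `|0 - fine (wasserstein2 (mu_ m) mu)| < t by near: m.
  by rewrite sub0r normrN => /(le_lt_trans (ler_norm _)).
have [h1 h2] := kF_wasserstein z t0 Wm.
split; rewrite -lee_fin [leRHS]EFinD [X in (_ <= X + _)%E]EFinM;
  rewrite !fineK ?kF_fin_num//;
  [apply: (le_trans h1)|apply: (le_trans h2)]; rewrite leeD2l// lee_fin.
Unshelve. all: by end_near. Qed.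

Lemma cvg_min_kF (z : 'M[R]_(N, k.+1)) (z_ : nat -> 'M[R]_(N, k.+1)) :
  minimizer (kF mu k.+1) z -> (forall m, minimizer (kF (mu_ m) k.+1) (z_ m)) ->
  (kF (mu_ m) k.+1 (z_ m) @[m --> \oo] --> kF mu k.+1 z)%E.
Proof.
move=> zmin z_min; rewrite -(fineK (kF_fin_num z mu2)).
apply/fine_cvgP; split; first by near=> m; exact: kF_fin_num.
apply/cvgrPdist_le => /= e e0.
have V0 := fine_kF_ge0 mu z; set V := fine (kF mu _ z) in V0 *.
have D0 : 0 < 2 * V + 4 by lra.
pose t := Num.min 1 (e / (2 * V + 4)).
have t0 : 0 < t by rewrite lt_min ltr01 divr_gt0.
have t1 : t <= 1 by rewrite ge_min lexx.
have te : t * (2 * V + 4) <= e by rewrite -ler_pdivlMr// ge_min lexx orbT.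
near=> m; apply: le_trans te.
have close : forall z : 'M[R]_(N, k.+1),
    fine (kF (mu_ m) k.+1 z) <= (1 + t) * fine (kF mu k.+1 z) + 2 * t /\
    fine (kF mu k.+1 z) <= (1 + t) * fine (kF (mu_ m) k.+1 z) + 2 * t.
  by near: m; exact: near_kF.
(* Each minimizer is tested in the other problem: F_m(z_m) <= F_m(z) and F(z) <= F(z_m). *)
apply: norm_sub_le_of_relative => //; first exact: fine_kF_ge0.
- apply: le_trans (close z).1.
  by rewrite fine_le ?kF_fin_num//; exact: z_min.
- apply: le_trans (close (z_ m)).2.
  by rewrite fine_le ?kF_fin_num//; exact: zmin.
Unshelve. all: by end_near. Qed.

Lemma minimizing_sequence (z_ : nat -> 'M[R]_(N, k.+1)) (z : 'M[R]_(N, k.+1)) :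
  (forall m, minimizer (kF (mu_ m) k.+1) (z_ m)) -> forall e : R, 0 < e ->
  \forall m \near \oo,
    fine (kF mu k.+1 (z_ m)) <= fine (kF mu k.+1 z) + e.
Proof.
move=> z_min e e0.
have V0 := fine_kF_ge0 mu z; set V := fine (kF mu _ z) in V0 *.
have D0 : 0 < 3 * V + 6 by lra.
(* The chain F(z_m) <= (1+t) F_m(z_m) + 2t <= (1+t)((1+t)V + 2t) + 2t is at most V + t(3V + 6) for t
   <= 1. *)
pose t := Num.min 1 (e / (3 * V + 6)).
have t0 : 0 < t by rewrite lt_min ltr01 divr_gt0.
have t1 : t <= 1 by rewrite ge_min lexx.
have te : t * (3 * V + 6) <= e by rewrite -ler_pdivlMr// ge_min lexx orbT.
near=> m.
have close : forall z : 'M[R]_(N, k.+1),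
    fine (kF (mu_ m) k.+1 z) <= (1 + t) * fine (kF mu k.+1 z) + 2 * t /\
    fine (kF mu k.+1 z) <= (1 + t) * fine (kF (mu_ m) k.+1 z) + 2 * t.
  by near: m; exact: near_kF.
apply: (le_trans (close (z_ m)).2).
have h1 : fine (kF (mu_ m) k.+1 (z_ m)) <= (1 + t) * V + 2 * t.
  apply: le_trans (close z).1.
  by rewrite fine_le ?kF_fin_num//; exact: z_min.
have h2 : (1 + t) * fine (kF (mu_ m) k.+1 (z_ m)) <= (1 + t) * ((1 + t) * V + 2 * t).
  by rewrite ler_wpM2l// addr_ge0// ltW.
have t2 : t * t <= t by rewrite ler_piMl// ltW.
have t2V : t * t * V <= t * V by rewrite ler_wpM2r.
lra.
Unshelve. all: by end_near. Qed.

Lemma precompact_minimizers (z_ : nat -> 'M[R]_(N, k.+1)) :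
  (`I_k.+1 #<= msupport mu)%card ->
  (forall m, minimizer (kF (mu_ m) k.+1) (z_ m)) -> precompact (range z_).
Proof.
move=> supp z_min.
have [z zmin] := exists_minimizer mu2 k.
have [c' Vc' degen] := minimizer_gap mu2 supp zmin.
have {}Vc' : fine (kF mu k.+1 z) < c' by rewrite -lte_fin fineK ?kF_fin_num.
set V := fine (kF mu k.+1 z) in Vc'.
(* Half the gap: eventually z_m lies in the sublevel set at V + e < c', which is bounded. *)
pose e := (c' - V) / 2.
have e0 : 0 < e by rewrite /e; lra.
have [B sub] := kF_sublevel_bounded mu2 (c := V + e) (c' := c')
  ltac:(rewrite /e; lra) degen.
have [M _ Msub] := minimizing_sequence z z_min e0.
(* [S] bounds the finitely many terms before that. *)
pose S := \sum_(m < M) \sum_(i < k.+1) enorm (col i (z_ m)).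
have S0 : 0 <= S by apply: sumr_ge0 => m _; apply: sumr_ge0.
apply: (@precompact_subset _ _
  [set w : 'M[R]_(N, k.+1) | forall i j, `|w i j| <= Num.max B S]).
  move=> _ [m _ <-] i j.
  apply: (@le_trans _ _ (enorm (col j (z_ m)))).
    by have := ler_coord_enorm (col j (z_ m)) i; rewrite mxE.
  rewrite le_max; case: (ltnP m M) => mM; apply/orP; [right|left].
    rewrite /S (bigD1 (Ordinal mM))//= (bigD1 j)//= -addrA lerDl.
    by rewrite addr_ge0// sumr_ge0// => ? _; apply: sumr_ge0.
  apply: sub; rewrite -(fineK (kF_fin_num _ mu2)) lee_fin.
  exact: Msub.
apply: compact_precompact; last exact: compact_mx_box.
exact: norm_hausdorff.
Qed.

Lemma accumulation_minimizer (z_ : nat -> 'M[R]_(N, k.+1)) (s : nat -> nat)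
    (z : 'M[R]_(N, k.+1)) :
  (forall m, minimizer (kF (mu_ m) k.+1) (z_ m)) -> increasing_seq s ->
  z_ (s m) @[m --> \oo] --> z -> minimizer (kF mu k.+1) z.
Proof.
move=> z_min sinc zs w.
rewrite -(fineK (kF_fin_num z mu2)) -(fineK (kF_fin_num w mu2)) lee_fin.
apply/ler_addgt0Pr => e e0.
have cF : fine (kF mu k.+1 (z_ (s m))) @[m --> \oo] --> fine (kF mu k.+1 z).
  exact: (cvg_comp _ _ zs (@continuous_fine_kF _ _ _ mu2 k z)).
(* This carries the eventual bound F(z_m) <= F(w) + e over to the subsequence; continuity of the
   energy then passes it to the limit. *)
have s_ge m : (m <= s m)%N.
  elim: m => // m IH; apply: (leq_ltn_trans IH).
  rewrite ltn_neqAle; have := sinc m.+1 m; have := sinc m m.+1.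
  by rewrite !leEnat leqnSn ltnn; case: ltngtP.
apply: (cvgr_to_le cF).
have [M _ Msub] := minimizing_sequence w z_min e0.
by exists M => // m /= Mm; apply: Msub => /=; exact: leq_trans (s_ge m).
Qed.

End stability.

Theorem theorem1p8 (R : realType) (N k : nat) (hk : (1 <= k)%N)
    (mu : probability (borelRn R N) R)
    (mu_moment : finite_second_moment mu)
    (suppk : (`I_k #<= msupport mu)%card)
    (mu_ : nat -> probability (borelRn R N) R)
    (mu_m_moment : forall m, finite_second_moment (mu_ m))
    (cvg_mu : wasserstein2 (mu_ m) mu @[m --> \oo] --> 0%E) :
  (exists (v_ : nat -> \bar R) (v : \bar R),
    [/\ forall m, is_min (kF (mu_ m) k) (v_ m),
        is_min (kF mu k) v
      & v_ m @[m --> \oo] --> v]) /\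
  (forall z_ : nat -> 'M[R]_(N, k),
    (forall m, minimizer (kF (mu_ m) k) (z_ m)) ->
    precompact (range z_) /\
    (forall (s : nat -> nat) (z : 'M[R]_(N, k)), increasing_seq s ->
      z_ (s m) @[m --> \oo] --> z -> minimizer (kF mu k) z)).
Proof.
case: k hk suppk => // k _ suppk; split.
  have [z zmin] := exists_minimizer mu_moment k.
  (* One minimizer is chosen for each m, to name the minimal values as a sequence. *)
  have [z_ z_min] := choice (fun m => exists_minimizer (mu_m_moment m) k).
  exists (fun m => kF (mu_ m) k.+1 (z_ m)), (kF mu k.+1 z); split.
  - by move=> m; exists (z_ m).
  - by exists z.
  - exact: cvg_min_kF.
move=> z_ z_min; split; first exact: precompact_minimizers cvg_mu _ suppk z_min.
move=> s z; exact: accumulation_minimizer.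
Qed.
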